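(* Given a set $E$, the convolution product $*$ is a commutative, associative binary operation on the set $\mathfrak{C}(E)$ of preclosure operators on $E$.
   Context: A preclosure operator on $E$ is a map $\mathfrak{c}:2^E\to2^E$ such that $A\subseteq\mathfrak{c}(A)\subseteq\mathfrak{c}(B)$ for all subsets $A\subseteq B$ of $E$. The convolution product of preclosure operators $\mathfrak{c},\mathfrak{s}$ on $E$ is the map $\mathfrak{c}*\mathfrak{s}:2^E\to2^E$ defined by $$(\mathfrak{c}*\mathfrak{s})(A)=\bigcap_{B\subseteq E}\big(\mathfrak{c}(A\cap B)\cup\mathfrak{s}(A\setminus B)\big),\qquad A\subseteq E.$$ *)

(* Defs.v *)
From mathcomp Require Import all_boot.
From mathcomp Require Import boolp classical_sets.

Set Implicit Arguments.
Unset Strict Implicit.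
Unset Printing Implicit Defensive.

Local Open Scope classical_set_scope.

Definition preclosure_op (E : Type) (c : set E -> set E) : Prop :=
  forall A B : set E, A `<=` B -> A `<=` c A /\ c A `<=` c B.

Definition convolution (E : Type) (c s : set E -> set E) : set E -> set E :=
  fun A => \bigcap_(B : set E) (c (A `&` B) `|` s (A `\` B)).

(* Main.v *)
Require Import Defs.
From mathcomp Require Import all_boot.
From mathcomp Require Import boolp classical_sets.

(** The formula defining the convolution splits [A] into the two pieces
    [A `&` B] and [A `\` B].  Since preclosure operators are monotone, one may
    let the two pieces grow and overlap: [x] lies in [convolution c s A] iff
    every cover of [A] by two sets [P] and [Q] satisfies [c P x] or [s Q x]
    ([convolution_cover]).  This form is symmetric in the two operators, whence
    commutativity.  Iterating it, [x] lies in the convolution of three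
    operators iff every cover of [A] by three sets [P], [Q], [R] satisfies
    [c P x] or [s Q x] or [t R x] ([convolution3_cover]).  That condition
    is invariant under rotating the three operators, so associativity follows
    from commutativity:
    (c * s) * t = (s * t) * c = c * (s * t). *)

Set Implicit Arguments.
Unset Strict Implicit.
Unset Printing Implicit Defensive.

Local Open Scope classical_set_scope.

Lemma preclosure_op_mono (E : Type) (c : set E -> set E) (A B : set E) :
  preclosure_op c -> A `<=` B -> c A `<=` c B.
Proof. by move=> hc /hc[]. Qed.

Lemma preclosure_op_ext (E : Type) (c : set E -> set E) (A : set E) :
  preclosure_op c -> A `<=` c A.
Proof. by move=> /(_ A A (@subset_refl _ A))[]. Qed.

(** Partitions of [A] are covers of [A]; conversely a cover [P], [Q] of [A]
    dominates the partition [A `&` P], [A `\` P], and monotonicity passes from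
    the smaller pieces to the larger ones. *)
Lemma convolution_cover (E : Type) (c s : set E -> set E) (A : set E) (x : E) :
  preclosure_op c -> preclosure_op s ->
  convolution c s A x <->
  (forall P Q : set E, A `<=` P `|` Q -> c P x \/ s Q x).
Proof.
move=> hc hs; split=> [h P Q hPQ | h B _].
  case: (h P I) => [cx | sx]; [left | right].
    exact: (preclosure_op_mono hc (@subIsetr _ A P) cx).
  apply: (preclosure_op_mono hs _ sx) => y [/hPQ[Py nPy | //]].
  by case: (nPy Py).
by apply: h; rewrite setUIDK.
Qed.

Lemma convolution_preclosure (E : Type) (c s : set E -> set E) :
  preclosure_op c -> preclosure_op s -> preclosure_op (convolution c s).
Proof.
move=> hc hs A B AB; split=> x.
  move=> Ax; apply/convolution_cover => // P Q /(_ x Ax)[Px | Qx].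
    by left; apply: preclosure_op_ext.
  by right; apply: preclosure_op_ext.
move/(convolution_cover _ _ hc hs) => h.
apply/convolution_cover => // P Q BPQ.
exact: h (subset_trans AB BPQ).
Qed.

Lemma convolutionC (E : Type) (c s : set E -> set E) :
  preclosure_op c -> preclosure_op s -> convolution c s = convolution s c.
Proof.
move=> hc hs; apply/funext => A; apply/seteqP.
split=> x.
  move/(convolution_cover _ _ hc hs) => h.
  apply/convolution_cover => // P Q; rewrite setUC => /h.
  by case; [right | left].
move/(convolution_cover _ _ hs hc) => h.
apply/convolution_cover => // P Q; rewrite setUC => /h.
by case; [right | left].
Qed.

(** Covers of [A] by three sets are the covers by two sets whose first member
    is itself covered by two sets. *)
Lemma convolution3_cover (E : Type) (c s t : set E -> set E) (A : set E)
    (x : E) :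
  preclosure_op c -> preclosure_op s -> preclosure_op t ->
  convolution (convolution c s) t A x <->
  (forall P Q R : set E, A `<=` P `|` Q `|` R -> c P x \/ s Q x \/ t R x).
Proof.
move=> hc hs ht; have hcs := convolution_preclosure hc hs.
split=> [/(convolution_cover _ _ hcs ht) h P Q R /h[] | h].
- move=> /(convolution_cover _ _ hc hs)/(_ P Q (@subset_refl _ _)).
  by case=> ?; [left | right; left].
- by right; right.
apply/convolution_cover => // U R AUR.
have [tx | ntx] := pselect (t R x); first by right.
left; apply/convolution_cover => // P Q UPQ.
have : A `<=` P `|` Q `|` R := subset_trans AUR (setSU UPQ).
by move=> /h[| []]; [left | right |].
Qed.

Lemma convolution_rot (E : Type) (c s t : set E -> set E) :
  preclosure_op c -> preclosure_op s -> preclosure_op t ->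
  convolution (convolution c s) t = convolution (convolution s t) c.
Proof.
move=> hc hs ht; apply/funext => A; apply/funext => x; apply/propext.
split.
  move/(convolution3_cover _ _ hc hs ht) => h.
  apply/convolution3_cover => // P Q R hA.
  have /h : A `<=` R `|` P `|` Q by rewrite -setUA setUC.
  by tauto.
move/(convolution3_cover _ _ hs ht hc) => h.
apply/convolution3_cover => // P Q R hA.
have /h : A `<=` Q `|` R `|` P by rewrite setUC setUA.
by tauto.
Qed.

Theorem theorem4p2 (E : Type) :
  (forall c s : set E -> set E,
     preclosure_op c -> preclosure_op s -> preclosure_op (convolution c s)) /\
  (forall c s : set E -> set E,
     preclosure_op c -> preclosure_op s -> convolution c s = convolution s c) /\
  (forall c s t : set E -> set E,
     preclosure_op c -> preclosure_op s -> preclosure_op t ->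
     convolution (convolution c s) t = convolution c (convolution s t)).
Proof.
split; first exact: convolution_preclosure.
split; first exact: convolutionC.
move=> c s t hc hs ht; rewrite convolution_rot //.
exact: convolutionC (convolution_preclosure hs ht) hc.
Qed.
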